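(* Let $a,b\ge 2$ be integers with $\gcd(a,b)=1$, let $k$ be a positive integer, and put $M_k:=\frac{(a-1)(b-1)}{k}$. The equation $ax+by=M_k$ is solvable if and only if $$k \text{ divides } \Theta-1\qquad\text{and}\qquad bk\text{ divides } ab-b-a\Theta+1 .$$ In that case, the unique nonnegative integral solution is $$(x,y)=\left(\frac{\Theta-1}{k},\ \frac{ab-b-a\Theta+1}{bk}\right).$$
   Context: An equation in the unknowns $x,y$ is called solvable if it has a solution with $x,y$ nonnegative integers. $\Theta$ denotes the unique multiplicative inverse of $a$ modulo $b$ with $1\le\Theta\le b-1$. *)

(* Defs.v *)
From mathcomp Require Import all_boot all_order all_algebra.

Set Implicit Arguments.
Unset Strict Implicit.
Unset Printing Implicit Defensive.

Import Order.TTheory GRing.Theory Num.Theory.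
Local Open Scope ring_scope.

(* The right-hand side [M] is rational: (a-1)(b-1)/k need not be an integer,
   and the equation is then simply not solvable. *)
Definition nonneg_solution (a b : int) (M : rat) (p : int * int) : Prop :=
  [/\ 0 <= p.1, 0 <= p.2 & (a * p.1 + b * p.2)%:~R = M].

Definition solvable_eq (a b : int) (M : rat) : Prop :=
  exists p : int * int, nonneg_solution a b M p.

Definition M_ (a b k : int) : rat := ((a - 1) * (b - 1))%:~R / k%:~R.

Definition mod_inverse (a b Theta : int) : Prop :=
  1 <= Theta <= b - 1 /\ (a * Theta = 1 %[mod b])%Z.

Lemma mod_inverse_exists_unique (a b : int) :
  2 <= b -> gcdz a b = 1 -> exists! Theta : int, mod_inverse a b Theta.
Proof.
move=> b2 /eqP cab.
have b0 : 0 < b by apply: lt_le_trans b2.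
have bn0 : b != 0 by rewrite gt_eqF.
have b1 : 1 < b by apply: lt_le_trans b2.
have le_b x : (x <= b - 1) = (x < b) by rewrite lerBrDr lezD1.
have [[u v] /= uv] := coprimezP _ _ cab.
have inv_u : (a * (u %% b)%Z = 1 %[mod b])%Z.
  by rewrite modzMmr mulrC -uv addrC modzMDl.
exists (u %% b)%Z; split.
  split=> //; rewrite le_b ltz_pmod // andbT -gtz0_ge1 lt_def modz_ge0 // andbT.
  by apply/eqP=> u0; move: inv_u; rewrite u0 mulr0 mod0z modz_small ?b1.
move=> t [/andP[t1 tb] inv_t].
have tbd : 0 <= t < `|b|.
  by rewrite (le_trans _ t1) //= gtr0_norm // -le_b.
rewrite -[RHS](modz_small tbd).
have au1 : (a * u = 1 %[mod b])%Z by rewrite -modzMmr inv_u.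
rewrite -[u]mulr1 -modzMmr -inv_t modzMmr.
by rewrite mulrCA mulrA -modzMml au1 modzMml mul1r gtr0_norm.
Qed.

(* Main.v *)
Require Import Defs.
From mathcomp Require Import all_boot all_order all_algebra.
From mathcomp Require Import zify ring.
Import Order.TTheory GRing.Theory Num.Theory.
Local Open Scope ring_scope.

(** Clearing the denominator, [a x + b y = (a - 1)(b - 1) / k] reads
    [a (k x + 1) + b (k y) = a b - b + 1].  For a nonnegative solution,
    [k x + 1] is thus an inverse of [a] modulo [b], and it lies between [1] and
    [b - 1] because [a (k x + 1) <= a b - b + 1 < a b]; hence
    [k x + 1 = Theta], which determines [x], and then [y] (lemma
    [nonneg_solution_coords]).  Conversely, the two divisibilities provide
    integers [x] and [y] that solve the equation (lemma
    [nonneg_solution_of_coords]): [x >= 0] because [Theta >= 1], and [y >= 0]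
    because [a b - b - a Theta + 1] is a multiple of [b] that exceeds [- b]. *)

Lemma nonneg_solutionP (a b k x y : int) : 0 < k ->
  nonneg_solution a b (M_ a b k) (x, y) <->
  [/\ 0 <= x, 0 <= y & (a * x + b * y) * k = (a - 1) * (b - 1)].
Proof.
move=> k0; have kn0 : k%:~R != 0 :> rat by rewrite intr_eq0 gt_eqF.
split=> -[/= x0 y0 E]; split=> //.
  by apply: (@intr_inj rat); rewrite intrM E divfK.
by rewrite /M_ -E intrM mulfK.
Qed.

(** A nonnegative solution is forced, whence both the necessity of the
    divisibilities and uniqueness. *)
Lemma nonneg_solution_coords (a b k Theta x y : int) :
    2 <= a -> 2 <= b -> gcdz a b = 1 -> 0 < k -> mod_inverse a b Theta ->
    nonneg_solution a b (M_ a b k) (x, y) ->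
  x * k = Theta - 1 /\ y * (b * k) = a * b - b - a * Theta + 1.
Proof.
move=> a2 b2 cab k0 [/andP[t1 tb] inv_t] /(nonneg_solutionP a b k x y k0).
move=> [x0 y0 E].
have xk0 : 0 <= x * k by rewrite mulr_ge0 // ltW.
have byk0 : 0 <= b * (y * k) by rewrite !mulr_ge0 //; lia.
have E' : a * (x * k + 1) + b * (y * k) = a * b - b + 1.
  have -> : a * (x * k + 1) + b * (y * k) = (a * x + b * y) * k + a by ring.
  by rewrite E; ring.
have xkb : x * k + 1 < b.
  have : a * (x * k + 1) < a * b by lia.
  by rewrite ltr_pM2l //; lia.
have dvd_b : (b %| x * k + 1 - Theta)%Z.
  rewrite -(@Gauss_dvdzr _ a); last by rewrite coprimez_sym; apply/eqP.
  have -> : a * (x * k + 1 - Theta) =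
      (a * (x * k + 1) + b * (y * k)) - b * (y * k) - a * Theta by ring.
  have -> : (a * (x * k + 1) + b * (y * k)) - b * (y * k) - a * Theta =
      b * (a - 1 - y * k) - (a * Theta - 1) by rewrite E'; ring.
  by rewrite rpredB ?dvdz_mulr // -eqz_mod_dvd; apply/eqP.
have xk : x * k = Theta - 1.
  (* [x * k + 1] and [Theta] both lie between [1] and [b - 1]. *)
  move: dvd_b => /dvdzP[q Eq].
  have : q = 0 by nia.
  by move=> q0; move: Eq; rewrite q0; lia.
split=> //.
have -> : y * (b * k) = a * (x * k + 1) + b * (y * k) - a * (x * k + 1) by ring.
by rewrite E' xk; ring.
Qed.

(** The bound [Theta <= b - 1] only gives the lower bound [a - b + 1], which may
    be negative; divisibility by [b] does the rest. *)
Lemma mod_inverse_rest_ge0 (a b Theta : int) :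
    2 <= a -> 2 <= b -> mod_inverse a b Theta ->
  0 <= a * b - b - a * Theta + 1.
Proof.
move=> a2 b2 [/andP[t1 tb] /eqP]; rewrite eqz_mod_dvd => /dvdzP[c Ec].
(* With [a * Theta - 1 = c * b], the quantity is [b * (a - 1 - c)], and [c < a]
   follows from [Theta <= b - 1]. *)
have aT : a * Theta <= a * (b - 1) by rewrite ler_pM2l //; lia.
have ca : c < a by nia.
by nia.
Qed.

Lemma nonneg_solution_of_coords (a b k Theta x y : int) :
    2 <= a -> 2 <= b -> 0 < k -> mod_inverse a b Theta ->
    x * k = Theta - 1 -> y * (b * k) = a * b - b - a * Theta + 1 ->
  nonneg_solution a b (M_ a b k) (x, y).
Proof.
move=> a2 b2 k0 inv_t Ex Ey; apply/nonneg_solutionP => //.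
have bk0 : 0 < b * k by rewrite mulr_gt0 //; lia.
split.
- by case: inv_t => /andP[t1 _] _; rewrite -(pmulr_lge0 _ k0) Ex subr_ge0.
- by rewrite -(pmulr_lge0 _ bk0) Ey mod_inverse_rest_ge0.
have -> : (a * x + b * y) * k = a * (x * k) + y * (b * k) by ring.
by rewrite Ex Ey; ring.
Qed.

Theorem corollary1p6 (a b k Theta : int)
    (ha : 2 <= a) (hb : 2 <= b) (hab : gcdz a b = 1) (hk : 0 < k)
    (hTheta : mod_inverse a b Theta) :
  (solvable_eq a b (M_ a b k) <->
    (k %| Theta - 1)%Z /\ (b * k %| a * b - b - a * Theta + 1)%Z) /\
  (solvable_eq a b (M_ a b k) ->
    exists x y : int,
      [/\ x%:~R = (Theta - 1)%:~R / k%:~R :> rat,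
          y%:~R = (a * b - b - a * Theta + 1)%:~R / (b * k)%:~R :> rat
        & unique (nonneg_solution a b (M_ a b k)) (x, y)]).
Proof.
have kn0 : k != 0 by rewrite gt_eqF.
have bkn0 : b * k != 0 by rewrite mulf_neq0 // gt_eqF //; lia.
have coords x y := nonneg_solution_coords a b k Theta x y ha hb hab hk hTheta.
split.
  split=> [[[x y] /coords[Ex Ey]]|[/dvdzP[x Ex] /dvdzP[y Ey]]].
    by split; apply/dvdzP; [exists x | exists y].
  by exists (x, y); apply: nonneg_solution_of_coords hTheta _ _.
move=> [[x y] sol_xy]; have [Ex Ey] := coords _ _ sol_xy.
exists x, y; split.
- by rewrite -Ex intrM mulfK // intr_eq0.
- by rewrite -Ey intrM mulfK // intr_eq0.
split=> // -[x' y'] /coords[Ex' Ey']; congr pair.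
  by apply: (mulIf kn0); rewrite Ex Ex'.
by apply: (mulIf bkn0); rewrite Ey Ey'.
Qed.
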